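(* Let $n\ge 2$. For every $j=1,\ldots,n-1$, the number $v_j^n$ of connected plane geometric graphs on $n$ points in convex position whose root vertex has visibility degree $j-1$ is $$v_{j}^{n} = \frac{j}{n-1}2^{n-1}\sum_{k=0}^{n-1}\binom{n-1}{k}\left(-\frac{1}{2}\right)^{k}\sum_{\ell= 0}^{n-j-1}\binom{n-2-k+\ell}{\ell}\binom{k+n-\ell-j-2}{n-\ell-j-1}2^{\ell}.$$
   Context: A geometric graph on a finite point set $\mathcal S\subseteq\mathbb R^2$ has vertex set $\mathcal S$ and edges that are straight-line segments with endpoints in $\mathcal S$; it is plane if no two edges intersect except at common endpoints. The vertices are points $p_1,\dots,p_n$ in convex position labelled in counter-clockwise order, with root vertex $p_n$. Two vertices are visible (from each other) if the line segment connecting them does not intersect the interior of any edge of the graph. The visibility degree of the root vertex $p_n$ is the number of vertices visible from an additional vertex $p_{n+1}$ inserted between $p_n$ and $p_1$ in convex position, minus $2$. Binomial coefficients are generalized: $\binom{a}{m}=\frac{a(a-1)\cdots(a-m+1)}{m!}$ for any integer $a$ and integer $m\ge 0$; in particular $\binom{-1}{0}=1$. *)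

(* Defs.v *)
From mathcomp Require Import all_boot all_order all_algebra.
From mathcomp Require Import boolp classical_sets set_interval reals convex.

Set Implicit Arguments.
Unset Strict Implicit.
Unset Printing Implicit Defensive.

Import Order.TTheory GRing.Theory Num.Theory.

Local Open Scope classical_set_scope.
Local Open Scope ring_scope.

Section Plane.
Context {R : realType}.
Implicit Types (a b c : 'rV[R]_2).

Definition segment a b : set 'rV[R]_2 :=
  [set (1 - t) *: a + t *: b | t in `[0, 1]].

(* The interior of an edge is the segment without its endpoints (the relative
   interior), not the topological interior in the plane. *)
Definition open_segment a b : set 'rV[R]_2 :=
  [set (1 - t) *: a + t *: b | t in `]0, 1[].

(* Twice the signed area of the triangle abc: positive iff a, b, c make a
   strict left turn. *)
Definition orient a b c : R :=
  (b 0 0 - a 0 0) * (c 0 1 - a 0 1) - (b 0 1 - a 0 1) * (c 0 0 - a 0 0).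

Definition convex_hull (A : set 'rV[R]_2) : set 'rV[R]_2 :=
  smallest (@convex_set R 'rV[R]_2) A.

(* Strict convex position: every point is a vertex of the hull.  In particular
   p is injective. *)
Definition convex_position n (p : 'I_n -> 'rV[R]_2) : Prop :=
  forall i, ~ convex_hull (p @` [set j | j != i]) (p i).

(* For points in convex position, this says that p_0, ..., p_(n-1) is the
   order in which the boundary of the hull is traversed counter-clockwise. *)
Definition ccw_labelled n (p : 'I_n -> 'rV[R]_2) : Prop :=
  forall i j k : 'I_n, (i < j)%N -> (j < k)%N -> 0 < orient (p i) (p j) (p k).

Definition ccw_convex n (p : 'I_n -> 'rV[R]_2) : Prop :=
  convex_position p /\ ccw_labelled p.

(* The points p_0, ..., p_(n-1) followed by q as a last point; ccw_convex of
   this family says that q lies between p_(n-1) and p_0 in convex position. *)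
Definition add_point n (p : 'I_n -> 'rV[R]_2) (q : 'rV[R]_2) :
    'I_n.+1 -> 'rV[R]_2 :=
  fun k => if unlift ord_max k is Some i then p i else q.

End Plane.

(* A geometric graph on the points p_0, ..., p_(n-1) is encoded by its set E of
   edges, an edge being the two-element set of the indices of its endpoints. *)
Section GeometricGraph.
Context {R : realType} {n : nat}.
Variable p : 'I_n -> 'rV[R]_2.
Implicit Types (E : {set {set 'I_n}}).

Definition is_graph E : bool := [forall e in E, #|e| == 2%N].

Definition adjacent E : rel 'I_n := fun i j => ([set i; j] \in E)%SET.

Definition connected_graph E : bool :=
  [forall i, forall j, connect (adjacent E) i j].

Definition plane_graph E : Prop :=
  forall i j k l : 'I_n, adjacent E i j -> adjacent E k l ->
    ([set i; j] != [set k; l])%SET ->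
  forall z, segment (p i) (p j) z -> segment (p k) (p l) z ->
    [set p i; p j] z /\ [set p k; p l] z.

Definition visible E (x y : 'rV[R]_2) : Prop :=
  forall k l : 'I_n, adjacent E k l ->
    segment x y `&` open_segment (p k) (p l) = set0.

(* Visibility degree of the root p_(n-1), where q is the additional point
   inserted between p_(n-1) and p_0.  The subtraction is in int. *)
Definition visibility_degree (q : 'rV[R]_2) E : int :=
  #|[pred i : 'I_n | `[< visible E q (p i) >]]|%:Z - 2.

Definition connected_plane_graphs (q : 'rV[R]_2) (d : int) :
    {set {set {set 'I_n}}} :=
  finset (fun E => [&& is_graph E, `[< plane_graph E >], connected_graph E
                     & visibility_degree q E == d]).

End GeometricGraph.

Definition gbinom (a : int) (m : nat) : rat :=
  (\prod_(i < m) (a - i%:Z))%:~R / (m`!)%:R.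

(* Main.v *)
(** Number the points 0, ..., n-1 and call x covered if some edge uv has
    u < x < v.  The inserted point sees exactly the uncovered points, so
    visibility degree j - 1 means j + 1 uncovered points.  Let V(a,j) be the number of connected
    noncrossing graphs on {a, ..., n-1} with j + 1 uncovered points.  Let c be the
    largest neighbour of a.  If a is a leaf, remove ac: this leaves a graph on
    {a+1, ..., n-1}, from which c is recovered as the j-th uncovered point from the
    right.  Otherwise let m be the second largest neighbour of a, and replace ac by
    mc: this uncovers m and nothing else, and only forgets whether mc was present.
    Hence V(a,j) = sum_(i >= j-1) V(a+1,i) + 2 V(a,j+1), that is
      V(a,j) - 3 V(a,j+1) + 2 V(a,j+2) = V(a+1,j-1).
    With N = n-1-a the solution is [X^N] A^j, where A (1-A) (1-2A) = X, and Lagrange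
    inversion gives j/N [t^(N-j)] ((1-t)(1-2t))^(-N).  The stated formula expands
    this power binomially, using 1/((1-t)(1-2t)) = 2/(1-2t) - 1/(1-t). *)
Require Import Defs.
From mathcomp Require Import boolp classical_sets set_interval reals.
From mathcomp Require Import all_boot all_order all_algebra.
From mathcomp Require Import zify ring lra.

Set Implicit Arguments.
Unset Strict Implicit.
Unset Printing Implicit Defensive.

Import Order.TTheory GRing.Theory Num.Theory.

(** * Finite bijections and paths in finite relations *)

Lemma eq_card_can (T U : finType) (A : {set T}) (B : {set U})
    (f : T -> U) (g : U -> T) :
  {in A, forall x, f x \in B /\ g (f x) = x} ->
  {in B, forall y, g y \in A /\ f (g y) = y} -> #|A| = #|B|.
Proof.
move=> fP gP; rewrite -(card_in_imset (f := f) (D := A)).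
  apply: eq_card => y; apply/imsetP/idP => [[x /fP[? _] ->] //|yB].
  by exists (g y); have [? ?] := gP y yB.
by move=> x y xA yA fxy; rewrite -(fP x xA).2 -(fP y yA).2 fxy.
Qed.

(** The map [f] may contract edges: sending a leaf to its neighbour, it shows that the graph stays
    connected when the leaf is removed. *)
Lemma connect_map (T : finType) (e e' : rel T) (f : T -> T) :
  (forall x y, e x y -> connect e' (f x) (f y)) ->
  forall x y, connect e x y -> connect e' (f x) (f y).
Proof.
move=> ee' x y /connectP[p + ->]; elim: p x => //= z p IH x /andP[/ee' xz /IH].
exact: connect_trans.
Qed.

Lemma connect_exit (T : finType) (e : rel T) (P : pred T) (x y : T) :
  connect e x y -> P x -> ~~ P y -> exists u v, [/\ e u v, P u & ~~ P v].
Proof.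
move=> /connectP[p + ->]; elim: p x => /= [x _ Px /negP //|z p IH x /andP[xz zp] Px].
by case: (boolP (P z)) => [Pz|Pz _]; [exact: IH | exists x, z].
Qed.

Lemma set2_eq (T : finType) (x y u v : T) :
  ([set x; y] == [set u; v]) = (x == u) && (y == v) || (x == v) && (y == u).
Proof.
apply/eqP/orP => [eq2|[]/andP[/eqP-> /eqP->] //]; last exact: setUC.
have yuv : y \in [set u; v] by rewrite -eq2 set22.
have uxy : u \in [set x; y] by rewrite eq2 set21.
have vxy : v \in [set x; y] by rewrite eq2 set22.
have /set2P[xu|xv] : x \in [set u; v] by rewrite -eq2 set21.
  left; rewrite xu eqxx /=; case/set2P: vxy => [vx|-> //].
  by move: yuv; rewrite vx xu setUid => /set1P->.
right; rewrite xv eqxx /=; case/set2P: uxy => [ux|-> //].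
by move: yuv; rewrite ux xv setUid => /set1P->.
Qed.

(** * Noncrossing connected graphs *)

Section Noncrossing.
Variable n' : nat.
Notation n := n'.+1.
Implicit Types (E : {set {set 'I_n}}) (x y z u v : 'I_n).

Lemma adjC E x y : adjacent E x y = adjacent E y x.
Proof. by rewrite /adjacent setUC. Qed.

Lemma adjU E x y u v : adjacent ([set u; v] |: E) x y =
  [|| (x == u) && (y == v), (x == v) && (y == u) | adjacent E x y].
Proof. by rewrite /adjacent in_setU1 set2_eq orbA. Qed.

Lemma adjD E x y u v : adjacent (E :\ [set u; v]) x y =
  ~~ ((x == u) && (y == v) || (x == v) && (y == u)) && adjacent E x y.
Proof. by rewrite /adjacent in_setD1 set2_eq. Qed.

(** Since [adjacent] is symmetric, this one order pattern accounts for every pair of crossing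
    chords. *)
Definition noncrossing E :=
  forall x y z u : 'I_n, x < y -> y < z -> z < u -> adjacent E x z -> adjacent E y u -> False.

Definition covered E x :=
  [exists u : 'I_n, exists v : 'I_n, [&& u < x, x < v & adjacent E u v]].

Definition uncovered a E := [set x : 'I_n | (a <= x) && ~~ covered E x].

(** The vertices below [a] stay in the type as isolated ones, so that graphs for different [a] share
    one type. *)
Definition edges_from a E :=
  {in E, forall e, exists u v : 'I_n, [/\ u < v, a <= u & e = [set u; v]]}.

Definition connected_from a E :=
  forall x y : 'I_n, a <= x -> a <= y -> connect (adjacent E) x y.

Definition ncc_from a E :=
  [/\ edges_from a E, noncrossing E & connected_from a E].

(** Here [k] counts uncovered vertices, so V(a,j) is [#|ncc a j.+1|]. *)
Definition ncc a k := [set E | `[< ncc_from a E >] & #|uncovered a E| == k].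

Definition ncc_ge a k := [set E | `[< ncc_from a E >] & k <= #|uncovered a E|].

Lemma nccP a k E :
  reflect (ncc_from a E /\ #|uncovered a E| = k) (E \in ncc a k).
Proof. by rewrite in_set; apply: (iffP andP) => -[/asboolP ? /eqP]. Qed.

Lemma ncc_geP a k E :
  reflect (ncc_from a E /\ k <= #|uncovered a E|) (E \in ncc_ge a k).
Proof. by rewrite in_set; apply: (iffP andP) => -[/asboolP]. Qed.

Lemma coveredP E x :
  reflect (exists u v : 'I_n, [/\ u < x, x < v & adjacent E u v]) (covered E x).
Proof.
apply: (iffP existsP) => [[u /existsP[v /and3P[]]] |[u [v [? ? ?]]]].
  by exists u, v.
by exists u; apply/existsP; exists v; apply/and3P.
Qed.

Lemma adj_from a E x y : edges_from a E -> adjacent E x y ->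
  [/\ a <= x, a <= y & x != y].
Proof.
move=> aE /aE[u [v [uv au /eqP]]].
rewrite set2_eq => /orP[]/andP[/eqP-> /eqP->]; rewrite -!val_eqE /=; split; lia.
Qed.

Lemma edges_fromP a E : edges_from a E <->
  (forall e, e \in E -> #|e| = 2) /\ (forall x y : 'I_n, adjacent E x y -> a <= x).
Proof.
split=> [aE|[E2 aE] e eE]; first split=> [e /aE[u [v [uv _ ->]]]|x y /(adj_from aE)[] //].
  by rewrite cards2 -val_eqE /= neq_ltn uv.
have /eqP/cards2P[u [v [uv def_e]]] := E2 e eE.
have adj_uv : adjacent E u v by rewrite /adjacent -def_e.
have := adj_uv; rewrite adjC => /aE av; have au := aE _ _ adj_uv.
have: val u != val v by rewrite val_eqE.
rewrite neq_ltn => /orP[] ltuv.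
  by exists u, v.
by exists v, u; rewrite setUC.
Qed.

(* The largest neighbour of x, or x itself if x has no larger neighbour. *)
Definition top E x := [arg max_(y > x | (y == x) || adjacent E x y) (y : nat)].

Lemma topP E x : [/\ (top E x == x) || adjacent E x (top E x), x <= top E x &
  forall y : 'I_n, adjacent E x y -> y <= top E x].
Proof.
rewrite /top; case: arg_maxnP => [|i Pi maxi]; first by rewrite eqxx.
by split=> // [|y xy]; apply: maxi; rewrite ?eqxx // xy orbT.
Qed.

Lemma top_adj E x : x < top E x -> adjacent E x (top E x).
Proof.
by move=> lt_t; have [/orP[/eqP eq_t|//] _ _] := topP E x; rewrite eq_t ltnn in lt_t.
Qed.

Lemma le_top E x y : adjacent E x y -> y <= top E x.
Proof. by have [_ _] := topP E x; apply. Qed.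

Lemma top_eq E x y : adjacent E x y -> x <= y ->
  (forall z : 'I_n, adjacent E x z -> z <= y) -> top E x = y.
Proof.
move=> xy lexy maxy; have [/orP[/eqP tx|/maxy t_le] le_t /(_ y xy) ley] := topP E x;
  apply: val_inj => /=; apply/eqP; rewrite eqn_leq ley ?t_le //.
by rewrite tx lexy.
Qed.

(** A path from [x] to the last vertex leaves the vertices up to [x] along an edge that would cover
    [x] unless it starts at [x]; so [x] has a larger neighbour. An edge over [top E x] would cover
    [x], cross the edge from [x] to [top E x], or be a longer edge at [x]. *)
Lemma uncovered_top a E x : ncc_from a E -> a <= x -> ~~ covered E x ->
  x < n' -> [/\ x < top E x, adjacent E x (top E x) & ~~ covered E (top E x)].
Proof.
move=> [aE nc conn] ax ucx xn.
have xt : x < top E x.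
  have an : a <= @ord_max n' by rewrite (leq_trans ax) 1?ltnW.
  have [|u [v [uv /= ux]]] :=
      connect_exit (P := fun y => y <= x) (conn x ord_max ax an) (leqnn x).
    by rewrite -ltnNge.
  rewrite -ltnNge => vx; apply: leq_trans (vx) _; apply: le_top.
  have -> : x = u; last by [].
  apply: contraNeq ucx => neq; apply/coveredP; exists u, v; split=> //.
  by move: neq; rewrite -val_eqE /=; lia.
have adjt := top_adj xt; split=> //.
apply/coveredP => -[u [v [ut tv uv]]].
have [ux|xu|/val_inj eqxu] := ltngtP u x.
- by case/coveredP: ucx; exists u, v; split=> //; apply: ltn_trans tv.
- exact: (nc x u (top E x) v).
- by move: uv; rewrite eqxu => /le_top; rewrite leqNgt tv.
Qed.

Lemma uncovered_first a E x : edges_from a E -> x <= a -> ~~ covered E x.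
Proof.
by move=> aE xa; apply/coveredP => -[u [v [ux _ /(adj_from aE)[]]]]; lia.
Qed.

Lemma uncovered_last E : ~~ covered E ord_max.
Proof. by apply/coveredP => -[u [v [_ +_]]] /=; have := ltn_ord v; rewrite ltnS /=; lia. Qed.

Lemma covered_adj E x y z : adjacent E x z -> x < y -> y < z -> covered E y.
Proof. by move=> xz xy yz; apply/coveredP; exists x, z. Qed.

Lemma adj_connectC E : connect_sym (adjacent E).
Proof. by apply: sym_connect_sym => x y; exact: adjC. Qed.

Lemma connected_hub a E z :
  (forall x : 'I_n, a <= x -> connect (adjacent E) x z) -> connected_from a E.
Proof.
by move=> Ez x y /Ez xz /Ez; rewrite adj_connectC; apply: connect_trans.
Qed.

Lemma connected_from_sub a E E' :
  (forall x y, adjacent E x y -> connect (adjacent E') x y) ->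
  connected_from a E -> connected_from a E'.
Proof. by move=> EE' Ec x y ax ay; apply: connect_sub (Ec _ _ ax ay). Qed.

Lemma edges_fromU a E u v : edges_from a E -> a <= u -> u < v ->
  edges_from a ([set u; v] |: E).
Proof. by move=> aE au uv e /setU1P[->|/aE //]; exists u, v. Qed.

Lemma edges_fromD a E e : edges_from a E -> edges_from a (E :\ e).
Proof. by move=> aE f /setD1P[_ /aE]. Qed.

Lemma edges_from_le a b E : b <= a -> edges_from a E -> edges_from b E.
Proof. by move=> ba aE e /aE[u [v [? ? ?]]]; exists u, v; split=> //; lia. Qed.

(** An edge of [E] that crosses the chord [uv] would cover [u] or [v]. *)
Lemma noncrossingU E u v : noncrossing E -> ~~ covered E u -> ~~ covered E v ->
  noncrossing ([set u; v] |: E).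
Proof.
move=> nc uu uv x y z w xy yz zw; rewrite !adjU.
case/or3P => [/andP[/eqP? /eqP?]|/andP[/eqP? /eqP?]|xzE];
  case/or3P => [/andP[/eqP? /eqP?]|/andP[/eqP? /eqP?]|ywE]; subst; try lia.
- by case/negP: uv; apply: covered_adj ywE _ _.
- by case/negP: uu; apply: covered_adj ywE _ _.
- by case/negP: uu; apply: covered_adj xzE _ _.
- by case/negP: uv; apply: covered_adj xzE _ _.
- exact: nc xzE ywE.
Qed.

Lemma noncrossingD E e : noncrossing E -> noncrossing (E :\ e).
Proof.
by move=> nc x y z u xy yz zu /setD1P[_ xz] /setD1P[_ yu]; apply: nc xz yu.
Qed.

Lemma coveredD E e x : ~~ covered E x -> ~~ covered (E :\ e) x.
Proof.
apply: contra => /coveredP[u [v [ux xv /setD1P[_ uv]]]].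
by apply/coveredP; exists u, v.
Qed.

Lemma top_neighbor E x : x < top E x ->
  [set x; top E x] |: (E :\ [set x; top E x]) = E.
Proof. by move=> /top_adj; apply: setD1K. Qed.

Lemma uncovered_between E x y z : adjacent E x z -> ~~ covered E y ->
  y <= x \/ z <= y.
Proof.
move=> xz ucy; have [|xy] := leqP y x; [by left|right].
by rewrite leqNgt; apply: contra ucy; apply: covered_adj xz _.
Qed.

(** * Attaching the first vertex as a leaf *)

Section Leaf.
Variables (E' : {set {set 'I_n}}) (x c : 'I_n).
Hypotheses (E'P : ncc_from x.+1 E') (c_in : c \in uncovered x.+1 E').
Let E := [set x; c] |: E'.

Let E'e : edges_from x.+1 E'. Proof. by case: E'P. Qed.

Lemma add_leaf_gt : x < c.
Proof. by move: c_in; rewrite inE => /andP[]. Qed.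

Lemma add_leaf_notin : [set x; c] \notin E'.
Proof. by apply/negP => /(adj_from E'e)[]; rewrite ltnn. Qed.

Lemma add_leaf_remove : E :\ [set x; c] = E'.
Proof. by rewrite setU1K // add_leaf_notin. Qed.

Lemma add_leaf_top : top E x = c.
Proof.
apply: top_eq => [||z]; first by rewrite adjU !eqxx.
  exact/ltnW/add_leaf_gt.
rewrite adjU eqxx /= => /or3P[/eqP->//|/andP[_ /eqP->]|/(adj_from E'e)[]].
  exact/ltnW/add_leaf_gt.
by rewrite ltnn.
Qed.

Lemma add_leaf_top0 : top E' x = x.
Proof.
have [/orP[/eqP //|/(adj_from E'e)[]]] := topP E' x; by rewrite ltnn.
Qed.

Lemma add_leaf_ncc : ncc_from x E.
Proof.
have [_ nc conn] := E'P; have xc := add_leaf_gt.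
move: (c_in); rewrite inE => /andP[_ ucc].
split.
- by apply: edges_fromU xc => //; apply: edges_from_le E'e.
- by apply: noncrossingU => //; apply: uncovered_first E'e _.
apply: (@connected_hub _ _ c) => y; rewrite leq_eqVlt => /orP[/eqP/val_inj<-|xy].
  by apply: connect1; rewrite adjU !eqxx.
apply: connect_sub (conn y c xy xc) => u v uv.
by apply: connect1; rewrite adjU uv !orbT.
Qed.

(** The new edge covers exactly the vertices strictly between [x] and [c]; the successor accounts
    for [x] itself. *)
Lemma add_leaf_uncovered :
  #|uncovered x E| = #|[set y in uncovered x.+1 E' | c <= y]|.+1.
Proof.
have [Ee _ _] := add_leaf_ncc; have xc := add_leaf_gt.
rewrite [RHS](_ : _ = #|x |: [set y in uncovered x.+1 E' | c <= y]|); last first.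
  by rewrite cardsU1 !inE ltnn.
congr #|pred_of_set _|; apply/setP=> y; rewrite !inE.
have [->|neq_yx] := eqVneq y x; first by rewrite leqnn (uncovered_first Ee).
have -> : (x < y) = (x <= y) by rewrite ltn_neqAle eq_sym val_eqE neq_yx.
rewrite -andbA; case: leqP => //= xy; apply/idP/andP => [ucy|[ucy cy]].
  have xcE : adjacent E x c by rewrite adjU !eqxx.
  split; first by rewrite -add_leaf_remove coveredD.
  have [yx|//] := uncovered_between xcE ucy.
  by case/eqP: neq_yx; apply: val_inj; apply/eqP; rewrite eqn_leq yx.
apply: contra ucy => /coveredP[u [v [uy yv]]]; rewrite adjU.
case/or3P => [/andP[/eqP? /eqP?]|/andP[/eqP? /eqP?]|uv]; subst; try lia.
by apply/coveredP; exists u, v.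
Qed.

End Leaf.

(** * Removing the first vertex when it is a leaf *)

Section RemoveLeaf.
Variables (E : {set {set 'I_n}}) (x : 'I_n).
Hypotheses (EP : ncc_from x E) (xn : x < n').
Let c := top E x.
Let E' := E :\ [set x; c].

Let Ee : edges_from x E. Proof. by case: EP. Qed.

Lemma root_top : [/\ x < c, adjacent E x c & ~~ covered E c].
Proof. exact: uncovered_top EP (leqnn x) (uncovered_first Ee (leqnn x)) xn. Qed.

(** The hypothesis [top E' x = x] expresses that [c] was the only neighbour of [x]. *)
Lemma remove_leaf_ncc : top E' x = x -> ncc_from x.+1 E' /\ c \in uncovered x.+1 E'.
Proof.
move=> leaf; have [_ nc conn] := EP; have [xc xcE ucc] := root_top.
have noE' : forall y, ~~ adjacent E' x y.
  move=> y; apply/negP => xy; have := le_top xy; rewrite leaf.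
  have [_] := adj_from (edges_fromD (e := [set x; c]) Ee) xy.
  by rewrite -val_eqE /=; lia.
split; last by rewrite inE xc coveredD.
split; last 1 first.
- move=> y z xy xz.
  (* Contracting [x] onto [c] turns a path of [E] into one of [E'] and fixes all vertices after
     [x]. *)
  have := @connect_map _ (adjacent E) (adjacent E') (fun u => if u == x then c else u).
  move=> /(_ _ y z (conn y z (ltnW xy) (ltnW xz))).
  have ne u : x < u -> (u == x) = false by move=> xu; rewrite -val_eqE gtn_eqF.
  rewrite !ne //; apply=> u v uv.
  have [/orP[]/andP[/eqP-> /eqP->]|neq] :=
    boolP ((u == x) && (v == c) || (u == c) && (v == x)).
  + by rewrite eqxx ne // connect0.
  + by rewrite eqxx ne // connect0.
  have uvE' : adjacent E' u v by rewrite adjD neq.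
  have [ux|_] := eqVneq u x; first by move: (noE' v); rewrite -ux uvE'.
  have [vx|_] := eqVneq v x; first by move: (noE' u); rewrite -vx adjC uvE'.
  exact: connect1.
- move=> e eE'; have [u [v [uv xu def_e]]] := edges_fromD Ee eE'.
  exists u, v; split=> //; rewrite ltn_neqAle xu andbT; apply/eqP => /val_inj xu'.
  by case/negP: (noE' v); rewrite xu' /adjacent -def_e.
- exact: noncrossingD.
Qed.

End RemoveLeaf.

(** * Replacing the longest edge at the first vertex *)

Section Flip.
Variables (E : {set {set 'I_n}}) (x : 'I_n).
Hypotheses (EP : ncc_from x E) (xn : x < n').
Let c := top E x.
Let m := top (E :\ [set x; c]) x.
Let F := [set m; c] |: (E :\ [set x; c]).
Hypothesis mx : m != x.

Let Ee : edges_from x E. Proof. by case: EP. Qed.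

Let xm : x < m.
Proof.
have [_ + _] := topP (E :\ [set x; c]) x.
by rewrite leq_eqVlt => /orP[|//]; rewrite val_eqE eq_sym (negPf mx).
Qed.

Let xmE' : adjacent (E :\ [set x; c]) x m. Proof. exact: top_adj. Qed.

Let xmE : adjacent E x m. Proof. by move: xmE'; rewrite adjD => /andP[]. Qed.

Let mc : m < c.
Proof.
rewrite ltn_neqAle le_top // andbT val_eqE.
by move: xmE'; rewrite adjD eqxx /= => /andP[+ _]; rewrite negb_or => /andP[].
Qed.

Let xcE : adjacent E x c. Proof. by have [] := root_top EP xn. Qed.

Let ucc : ~~ covered E c. Proof. by have [] := root_top EP xn. Qed.

(** An edge over [m] would either start at [x], against the choice of [m] as largest remaining
    neighbour, or cross the edge [xm]. *)
Let ucm : ~~ covered (E :\ [set x; c]) m.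
Proof.
have [_ nc _] := EP; apply/coveredP => -[u [v [um mv uv]]].
have [xu _ _] := adj_from (edges_fromD Ee) uv.
move: xu; rewrite leq_eqVlt => /orP[/eqP/val_inj xu|xu].
  by move: uv; rewrite -xu => /le_top; rewrite -/m; lia.
by move: uv; rewrite adjD => /andP[_]; apply: nc xmE.
Qed.

(** Once [xc] is removed, both [m] and [c] are uncovered, so [mc] can be added without a crossing;
    the path through [m] replaces the edge [xc]. *)
Lemma flip_ncc : ncc_from x F.
Proof.
have [_ nc conn] := EP; split.
- by apply: edges_fromU => //; [exact: edges_fromD | exact: ltnW].
- by apply: noncrossingU => //; [exact: noncrossingD | exact: coveredD].
apply: connected_from_sub conn => u v uv.
have xcF : connect (adjacent F) x c.
  apply: (@connect_trans _ _ m); apply: connect1; last by rewrite adjU !eqxx.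
  by rewrite adjU xmE' !orbT.
have [/orP[]/andP[/eqP-> /eqP->]|neq] :=
  boolP ((u == x) && (v == c) || (u == c) && (v == x)).
- exact: xcF.
- by rewrite adj_connectC.
by apply: connect1; rewrite adjU adjD neq uv !orbT.
Qed.

(** Together with [flip_top2] this recovers [m] and then [c] from [F] alone, so the flip loses only
    whether [mc] was an edge of [E]. *)
Lemma flip_top : top F x = m.
Proof.
apply: top_eq => [|| z]; [by rewrite adjU xmE' !orbT | exact: ltnW |].
rewrite adjU [x == m]eq_sym (negPf mx) /=; case/orP => [/andP[/eqP xc]|/le_top //].
by move: mc; rewrite -xc; lia.
Qed.

Lemma flip_top2 : top F m = c.
Proof.
apply: top_eq => [|| z]; [by rewrite adjU !eqxx | exact: ltnW |].
rewrite adjU => /or3P[/andP[_ /eqP->]//|/andP[/eqP eq_mc _]|].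
  by have := mc; rewrite eq_mc ltnn.
rewrite adjD => /andP[_ mz]; rewrite leqNgt; apply: contra ucc => cz.
exact: covered_adj mz _ _.
Qed.

(** The edges [xm] and [mc] of [F] cover all that [xc] covered, except [m]. *)
Lemma flip_uncovered : #|uncovered x F| = #|uncovered x E|.+1.
Proof.
have [_ nc conn] := EP.
have m_notin : m \notin uncovered x E.
  by rewrite inE (covered_adj xcE) // andbF.
rewrite [RHS](_ : _ = #|m |: uncovered x E|); last by rewrite cardsU1 m_notin.
congr #|pred_of_set _|; apply/setP=> y; rewrite !inE.
have [->|neq_ym] := eqVneq y m.
  rewrite ltnW //=; apply/coveredP => -[u [v [um mv]]]; rewrite adjU.
  case/or3P => [/andP[/eqP ? /eqP ?]|/andP[/eqP ? /eqP ?]|uv]; try (subst u v; lia).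
  by case/coveredP: ucm; exists u, v.
case: leqP => //= xy; congr (~~ _); apply/coveredP/coveredP => -[u [v [uy yv uv]]].
  move: uv; rewrite adjU.
  case/or3P => [/andP[/eqP ? /eqP ?]|/andP[/eqP ? /eqP ?]|uv]; try (subst u v; lia).
    by exists x, c; split=> //; subst u v; lia.
  by exists u, v; split=> //; move: uv; rewrite adjD => /andP[].
have [/orP[]/andP[/eqP ? /eqP ?]|neq] :=
  boolP ((u == x) && (v == c) || (u == c) && (v == x)); last first.
- by exists u, v; split=> //; rewrite adjU adjD neq uv !orbT.
- by subst u v; lia.
have [ym|my|/val_inj ym] := ltngtP y m.
- by exists x, m; split; rewrite ?adjU ?xmE' ?orbT //; subst u.
- by exists m, c; split; rewrite ?adjU ?eqxx //; subst v.
by rewrite ym eqxx in neq_ym.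
Qed.

End Flip.

(** * The two preimages of a graph under the flip *)

Section Unflip.
Variables (F : {set {set 'I_n}}) (x : 'I_n) (b : bool).
Hypotheses (FP : ncc_from x F) (xn : x < n') (F3 : 2 < #|uncovered x F|).
Let m := top F x.
Let c := top F m.
(** The boolean [b] tells whether the preimage contains [mc]. *)
Let G := if b then F else F :\ [set m; c].
Let E := [set x; c] |: G.

Let Fe : edges_from x F. Proof. by case: FP. Qed.

Let xm : x < m. Proof. by have [] := root_top FP xn. Qed.

Let xmF : adjacent F x m. Proof. by have [] := root_top FP xn. Qed.

Let ucm : ~~ covered F m. Proof. by have [] := root_top FP xn. Qed.

(** If [m] were the last vertex, the edge [xm] would leave only [x] and [m] uncovered; the third
    uncovered vertex excludes this, so [m] has a larger neighbour [c]. *)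
Let mn : m < n'.
Proof.
rewrite ltnNge; apply/negP => nm.
suff /subset_leq_card : uncovered x F \subset [set x; m].
  by move=> /(leq_trans F3); rewrite cards2; case: (x != m).
apply/subsetP=> y; rewrite !inE => /andP[xy ucy]; rewrite -!val_eqE /=.
have := ltn_ord y; case: (uncovered_between xmF ucy); lia.
Qed.

Let c_top : [/\ m < c, adjacent F m c & ~~ covered F c].
Proof. exact: uncovered_top FP (ltnW xm) ucm mn. Qed.

Let xcF : ~~ adjacent F x c.
Proof. by have [mc _ _] := c_top; apply: contraL mc => /le_top; rewrite -leqNgt. Qed.

Let GF u v : adjacent G u v -> adjacent F u v.
Proof. by rewrite /G; case: b => //; rewrite adjD => /andP[]. Qed.

Let xmG : adjacent G x m.
Proof.
have [mc _ _] := c_top.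
rewrite /G; case: b => //; rewrite adjD xmF andbT -!val_eqE /=; lia.
Qed.

Lemma unflip_remove : E :\ [set x; c] = G.
Proof. by rewrite setU1K //; apply: contra xcF => /GF. Qed.

Lemma unflip_top : top E x = c.
Proof.
have [mc _ _] := c_top; have xc := ltn_trans xm mc.
apply: top_eq => [||z]; [by rewrite adjU !eqxx | exact: ltnW |].
rewrite adjU => /or3P[/andP[_ /eqP->]//|/andP[_ /eqP->]|]; first exact: ltnW.
by move=> /GF/le_top zm; apply: leq_trans zm (ltnW mc).
Qed.

Lemma unflip_top2 : top (E :\ [set x; c]) x = m.
Proof.
rewrite unflip_remove; apply: top_eq => //; first exact: ltnW.
by move=> z /GF/le_top.
Qed.

Lemma unflipK : [set m; c] |: (E :\ [set x; c]) = F.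
Proof.
have [_ mcF _] := c_top; rewrite unflip_remove /G.
by case: b; [apply/setUidPr; rewrite sub1set | rewrite setD1K].
Qed.

Lemma unflip_mem : ([set m; c] \in E) = b.
Proof.
have [mc mcF _] := c_top; rewrite /E in_setU1 set2_eq -!val_eqE /= /G.
rewrite [(m == x :> nat)]gtn_eqF // [(m == c :> nat)]ltn_eqF //=.
by case: b; rewrite // in_setD1 eqxx.
Qed.

Lemma unflip_ncc : ncc_from x E.
Proof.
have [mc mcF ucc] := c_top; have [_ nc conn] := FP; have xc := ltn_trans xm mc.
have xx := uncovered_first Fe (leqnn x).
split.
- apply: edges_fromU => //; rewrite /G; case: b => //; exact: edges_fromD.
- rewrite /E /G; case: b; apply: noncrossingU => //; rewrite ?coveredD //.
  exact: noncrossingD.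
apply: connected_from_sub conn => u v uv.
(* The detour through [x] joins [m] and [c] even when [mc] is dropped. *)
have mcE : connect (adjacent E) m c.
  apply: (@connect_trans _ _ x); apply: connect1; last by rewrite adjU !eqxx.
  by rewrite adjC adjU xmG !orbT.
have [/orP[]/andP[/eqP-> /eqP->]|neq] :=
  boolP ((u == m) && (v == c) || (u == c) && (v == m)).
- exact: mcE.
- by rewrite adj_connectC.
apply: connect1; rewrite adjU; apply/orP; right; apply/orP; right.
by rewrite /G; case: b; rewrite ?adjD ?neq.
Qed.

End Unflip.

(** The count starts with 1 at the largest element; the default [ord0] is returned only when [k] is
    outside the range from 1 to [#|S|]. *)
Definition nth_from_last (S : {set 'I_n}) k : 'I_n :=
  odflt ord0 [pick c in S | #|[set y in S | c <= y]| == k].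

Lemma card_above_inj (S : {set 'I_n}) x y : x \in S -> y \in S ->
  #|[set z in S | x <= z]| = #|[set z in S | y <= z]| -> x = y.
Proof.
wlog xy : x y / x <= y => [wl xS yS eqxy|xS yS eqxy].
  by have [xy|/ltnW yx] := leqP x y; [exact: wl | symmetry; apply: wl].
apply/val_inj/eqP; rewrite eqn_leq xy /=.
have : [set z in S | y <= z] == [set z in S | x <= z].
  rewrite eqEcard eqxy leqnn andbT; apply/subsetP => z; rewrite !inE => /andP[-> yz].
  exact: leq_trans yz.
by move=> /eqP/setP/(_ x); rewrite !inE xS leqnn.
Qed.

(** Induction on [k]: start at the maximum, then pass to the largest element of [S] below the
    previous one. *)
Lemma card_above_ex (S : {set 'I_n}) k : 0 < k <= #|S| ->
  exists2 c, c \in S & #|[set y in S | c <= y]| = k.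
Proof.
elim: k => // -[_ /= S0|k IH /= kS].
  have [c0 c0S] : exists c, c \in S by apply/set0Pn; rewrite -card_gt0.
  exists [arg max_(c > c0 in S) c]; first by case: arg_maxnP.
  case: arg_maxnP => // c cS cmax; rewrite -(cards1 c); apply: eq_card => y.
  rewrite !inE; apply/andP/eqP => [[/cmax /= yc cy]|->]; last by rewrite cS.
  by apply/val_inj/eqP; rewrite eqn_leq yc.
have [|c cS ck] := IH; first exact: ltnW.
have [d0 d0P] : exists d, (d \in S) && (d < c).
  apply/existsP; apply: contraTT kS => /existsPn noS; rewrite -leqNgt -ck.
  apply/subset_leq_card/subsetP => y yS; rewrite inE yS leqNgt.
  by have := noS y; rewrite yS.
exists [arg max_(d > d0 | (d \in S) && (d < c)) d]; first by case: arg_maxnP => // d /andP[].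
case: arg_maxnP => // d /andP[dS dc] dmax.
rewrite -ck -[RHS](_ : #|d |: [set y in S | c <= y]| = _).
  apply: eq_card => y; rewrite !inE; apply/andP/orP => [[yS]|[/eqP->//|/andP[yS cy]]].
    rewrite leq_eqVlt => /orP[/eqP/val_inj->|dy]; [by left|right].
    rewrite yS leqNgt; apply: contraL dy => yc; rewrite -leqNgt.
    by apply: dmax; rewrite yS.
  by split=> //; apply: leq_trans cy; apply: ltnW.
by rewrite cardsU1 inE leqNgt dc andbF.
Qed.

Lemma nth_from_lastP (S : {set 'I_n}) k : 0 < k <= #|S| ->
  nth_from_last S k \in S /\ #|[set y in S | nth_from_last S k <= y]| = k.
Proof.
move=> /card_above_ex[c cS ck]; rewrite /nth_from_last.
case: pickP => [d /andP[dS /eqP//]|/(_ c)]; by rewrite cS ck eqxx.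
Qed.

(** This is the first recurrence for V(x,k). The tail sum appears as [ncc_ge], the graphs that have
    a k-th uncovered vertex from the right to which the leaf [x] can be attached. *)
Lemma ncc_rec x k : x < n' -> 0 < k ->
  #|ncc x k.+1| = #|ncc_ge x.+1 k| + #|ncc x k.+2|.*2.
Proof.
move=> xn k0.
pose rem E := E :\ [set x; top E x].
pose mid E := top (rem E) x.
pose P1 E := mid E == x.
pose P2 E := [set mid E; top E x] \in E.
(* [A1] holds the graphs where [x] is a leaf; [A2 b] holds the others, with [b] telling whether the
   edge from [mid E] to [top E x] is present. *)
pose A1 := [set E in ncc x k.+1 | P1 E].
pose A2 b := [set E in ncc x k.+1 | ~~ P1 E & P2 E == b].
have -> : #|ncc x k.+1| = #|A1| + (#|A2 true| + #|A2 false|).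
  rewrite -(cardsID [set E | P1 E]); congr (_ + _).
    by apply: eq_card => E; rewrite !(in_setI, in_set).
  rewrite -(cardsID [set E | P2 E]); congr (_ + _); apply: eq_card => E.
    rewrite !(in_setI, in_setD, in_set) eqb_id.
    by case: (P1 E); rewrite ?andbF //= -!andbA.
  rewrite !(in_setI, in_setD, in_set) eqbF_neg.
  by case: (P1 E); rewrite ?andbF //= andbC.
have -> : #|A1| = #|ncc_ge x.+1 k|.
  pose g E := [set x; nth_from_last (uncovered x.+1 E) k] |: E.
  apply: (@eq_card_can _ _ _ _ rem g) => E.
    rewrite in_set => /andP[/nccP[EP Ek] /eqP leaf].
    have [remP topR] := remove_leaf_ncc EP xn leaf.
    have [xt _ _] := root_top EP xn.
    (* Applied to [rem E], the count identifies [top E x] as its k-th uncovered vertex from the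
       right. *)
    have := add_leaf_uncovered remP topR; rewrite top_neighbor // Ek => -[kE].
    have kr : k <= #|uncovered x.+1 (rem E)|.
      rewrite kE; apply/subset_leq_card/subsetP => y; by rewrite inE => /andP[].
    split; first exact/ncc_geP.
    have [|nS nk] := @nth_from_lastP (uncovered x.+1 (rem E)) k; first by rewrite k0.
    rewrite /g (_ : nth_from_last _ _ = top E x) ?top_neighbor //.
    by apply: card_above_inj nS topR _; rewrite nk.
  move=> /ncc_geP[EP kE].
  have [|nS nk] := @nth_from_lastP (uncovered x.+1 E) k; first by rewrite k0.
  have topg := add_leaf_top EP nS.
  have remg : rem (g E) = E by rewrite /rem topg add_leaf_remove.
  split=> //; rewrite in_set /P1 /mid remg add_leaf_top0 // eqxx andbT.
  by apply/nccP; rewrite (add_leaf_uncovered EP nS) nk; split=> //; apply: add_leaf_ncc.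
have A2E b : #|A2 b| = #|ncc x k.+2|.
  pose f E := [set mid E; top E x] |: rem E.
  pose g F := let m := top F x in let c := top F m in
    [set x; c] |: (if b then F else F :\ [set m; c]).
  apply: (@eq_card_can _ _ _ _ f g) => E.
    rewrite in_set => /andP[/nccP[EP Ek] /andP[nP1 /eqP P2b]].
    have [xt _ _] := root_top EP xn.
    split.
      by apply/nccP; rewrite (flip_uncovered EP xn nP1) Ek; split=> //; apply: flip_ncc.
    rewrite /g (flip_top EP xn nP1) (flip_top2 EP xn nP1) /=.
    have mcx : [set mid E; top E x] != [set x; top E x].
      have /negPf mEx : mid E != x := nP1.
      by rewrite set2_eq eqxx andbT mEx /=; apply: contraFN mEx => /andP[/eqP->].
    case: b {g} P2b => P2E.
      by rewrite /f [_ |: rem E](setUidPr _) ?top_neighbor // sub1set in_setD1 mcx.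
    by rewrite setU1K ?top_neighbor // in_setD1 mcx; apply/negbT.
  move=> /nccP[FP Fk].
  (* This is where [0 < k] enters. *)
  have F3 : 2 < #|uncovered x E| by rewrite Fk.
  have gP := unflip_ncc b FP xn F3.
  have topg := unflip_top b FP xn F3.
  have midg : mid (g E) = top E x by rewrite /mid /rem topg (unflip_top2 b FP xn F3).
  have fg : f (g E) = E by rewrite /f midg /rem topg (unflipK b FP xn F3).
  have nP1 : ~~ P1 (g E).
    rewrite /P1 midg -val_eqE /= gtn_eqF //; by have [] := root_top FP xn.
  split=> //; rewrite in_set nP1 /P2 midg topg (unflip_mem b FP xn F3) eqxx !andbT.
  apply/nccP; split=> //; apply: succn_inj.
  by rewrite -Fk -{2}fg (flip_uncovered gP xn nP1).
by rewrite !A2E addnn.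
Qed.

End Noncrossing.

Local Open Scope ring_scope.

(** * Coefficients of powers of 1/((1-X)(1-2X)) *)

Lemma gbinom0 a : gbinom a 0 = 1.
Proof. by rewrite /gbinom big_ord0 divr1. Qed.

(** Pascal's rule for an integer upper index. With P the product of the first [m] factors for [a],
    the two products of length [m + 1] are (a+1)P and P(a-m), which differ by (m+1)P. *)
Lemma gbinomS (a : int) m : gbinom (a + 1) m.+1 = gbinom a m.+1 + gbinom a m.
Proof.
have m0 : m.+1%:R != 0 :> rat by rewrite pnatr_eq0.
have f0 : m`!%:R != 0 :> rat by rewrite pnatr_eq0 -lt0n fact_gt0.
rewrite /gbinom big_ord_recl big_ord_recr /= factS natrM.
rewrite (eq_bigr (fun i : 'I_m => a - i%:Z)) => [|i _]; last first.
  by rewrite /bump leq0n /= PoszD; ring.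
set p := \prod_(i < m) _; rewrite !rmorphM /= rmorphD /= rmorphB /= !subr0.
by rewrite -[m.+1]addn1 !natrD !pmulrn in m0 *; field; apply/andP.
Qed.

Lemma gbinom_small (m : nat) : gbinom m%:Z m.+1 = 0.
Proof.
by rewrite /gbinom big_ord_recr /= subrr mulr0 mul0r.
Qed.

Lemma gbinom_nat (N k : nat) : gbinom N%:Z k = 'C(N, k)%:R.
Proof.
elim: N k => [|N IH] [|k]; rewrite ?gbinom0 ?bin0 //.
  rewrite /gbinom big_ord_recl subrr mul0r mul0r bin0n //.
by rewrite -addn1 PoszD gbinomS !IH addn1 binS natrD.
Qed.

Section TruncatedSeries.
Variable M : nat.

(** The series 1/(1-rX) cut off at degree [M]: series identities become polynomial identities modulo
    ['X^M], and coefficients are meaningful below [M]. *)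
Definition geom (r : rat) : {poly rat} := \sum_(i < M) (r *: 'X) ^+ i.

Lemma geomE r : (1 - r *: 'X) * geom r = 1 - (r ^+ M) *: 'X^M.
Proof. by rewrite -exprZn -[1 - _ ^+ _]opprB subrX1 -mulNr opprB. Qed.

(** Modulo ['X^M], multiplying [geom r ^+ k.+1] by 1-rX gives [geom r ^+ k], which is Pascal's rule
    on coefficients. The upper index must be an integer: for [k = l = 0] it is -1. *)
Lemma coef_geomX r k l : (l < M)%N ->
  (geom r ^+ k)`_l = r ^+ l * gbinom (k%:Z - 1 + l%:Z) l.
Proof.
elim: k l => [|k IHk] l lM.
  rewrite expr0 coef1; case: l lM => [|l] _; first by rewrite gbinom0 mulr1.
  by rewrite (_ : _ + _ = l :> int) ?gbinom_small ?mulr0 //; lia.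
have recl : geom r ^+ k.+1 = r *: (geom r ^+ k.+1 * 'X) + geom r ^+ k
    - r ^+ M *: (geom r ^+ k * 'X^M).
  have e : geom r ^+ k - r ^+ M *: (geom r ^+ k * 'X^M) =
      (1 - r *: 'X) * geom r * geom r ^+ k.
    by rewrite geomE mulrBl mul1r -scalerAl [_ * 'X^M]mulrC.
  by rewrite -addrA e exprS -!mul_polyC; ring.
elim: l lM => [|l IHl] lM.
  rewrite recl coefB coefD !coefZ coefMX coefMXn lM !mulr0 add0r subr0 IHk //.
  by rewrite !gbinom0.
rewrite recl coefB coefD !coefZ coefMX coefMXn lM !mulr0 subr0 IHk // IHl 1?ltnW //=.
have -> : k.+1%:Z - 1 + l.+1 = (k%:Z + l%:Z) + 1 by lia.
have -> : k.+1%:Z - 1 + l = k%:Z + l%:Z by lia.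
have -> : k%:Z - 1 + l.+1 = k%:Z + l%:Z by lia.
by rewrite gbinomS exprS; ring.
Qed.

(* 1/((1-X)(1-2X)) modulo X^M, in partial fractions. *)
Definition phi : {poly rat} := 2 *: geom 2 - geom 1.

Lemma coef_phiX N m : (m < M)%N -> (phi ^+ N)`_m =
  2 ^+ N * \sum_(0 <= k < N.+1) gbinom N%:Z k * (- (1 / 2)) ^+ k *
    \sum_(0 <= l < m.+1) gbinom (N%:Z - 1 - k%:Z + l%:Z) l *
      gbinom (k%:Z - 1 + (m - l)%:Z) (m - l) * 2 ^+ l.
Proof.
move=> mM; rewrite exprDn coef_sum mulr_sumr big_mkord; apply: eq_bigr => k _.
have kN : (k <= N)%N by rewrite -ltnS.
rewrite coefMn -[- geom 1]scaleN1r !exprZn -scalerAl -scalerAr !coefZ coefM.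
rewrite gbinom_nat big_mkord.
rewrite (eq_bigr (fun l : 'I_m.+1 => gbinom (N%:Z - 1 - k%:Z + l%:Z) l *
    gbinom (k%:Z - 1 + (m - l)%:Z) (m - l) * 2 ^+ l)) => [|l _].
  (* The constants combine as 2^(N-k) (-1)^k = 2^N (-1/2)^k. *)
  set S := \sum_(_ < _) _.
  have -> : 2 ^+ N = 2 ^+ (N - k) * 2 ^+ k :> rat by rewrite -exprD subnK.
  have -> : (-1) ^+ k = 2 ^+ k * (- (1 / 2)) ^+ k :> rat.
    by rewrite -exprMn; congr (_ ^+ k).
  by rewrite -mulr_natl; ring.
have lm : (l <= m)%N by rewrite -ltnS.
rewrite !coef_geomX ?expr1n ?mul1r; [|lia|lia].
have -> : (N - k)%:Z - 1 + l = N%:Z - 1 - k%:Z + l by lia.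
by rewrite [LHS]mulrC [LHS]mulrA [LHS]mulrAC [_ * gbinom (N%:Z - _ - _ + _) _]mulrC.
Qed.

Lemma phiE : exists R, (1 - 'X) * (1 - 2 *: 'X) * phi = 1 + 'X^M * R.
Proof.
exists ((1 - 2 *: 'X) - (2 * 2 ^+ M) *: (1 - 'X)).
have := geomE 1; have := geomE 2; rewrite expr1n !scale1r => e2 e1.
have -> : (1 - 'X) * (1 - 2 *: 'X) * phi =
   2 *: ((1 - 'X) * ((1 - 2 *: 'X) * geom 2)) - (1 - 2 *: 'X) * ((1 - 'X) * geom 1).
  by rewrite /phi -!mul_polyC; ring.
by rewrite e1 e2 -!mul_polyC polyCM; ring.
Qed.

Lemma coef_phiX0 N : (0 < M)%N -> (phi ^+ N)`_0 = 1.
Proof.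
move=> M0; rewrite -horner_coef0 horner_exp horner_coef0.
rewrite coefB coefZ -[geom 2]expr1 -[geom 1]expr1 !coef_geomX // !gbinom0 !expr0 !mulr1.
by rewrite (_ : 2 - 1 = 1) ?expr1n.
Qed.

(** Compare coefficients in [phi ^+ N] = (1-3X+2X^2) [phi ^+ N.+1] modulo ['X^M]; the matches set
    coefficients of negative index to 0. *)
Lemma coef_phiX_rec N m : (m < M)%N ->
  (phi ^+ N)`_m = (phi ^+ N.+1)`_m
    - 3 * (if m is m1.+1 then (phi ^+ N.+1)`_m1 else 0)
    + 2 * (if m is m2.+2 then (phi ^+ N.+1)`_m2 else 0).
Proof.
move=> mM; have [R phiR] := phiE.
have e : phi ^+ N = phi ^+ N.+1 - 3 *: (phi ^+ N.+1 * 'X)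
    + 2 *: (phi ^+ N.+1 * 'X^2) - 'X^M * (R * phi ^+ N).
  apply: (addIr ('X^M * (R * phi ^+ N))).
  rewrite -[phi ^+ N + _](_ : (1 - 'X) * (1 - 2 *: 'X) * phi ^+ N.+1 = _).
    by rewrite -!mul_polyC; ring.
  by rewrite exprS [LHS]mulrA phiR mulrDl mul1r [RHS]addrC addrC mulrA.
rewrite {1}e coefB coefD coefB !coefZ coefMX coefMXn coefXnM mM subr0.
by case: m {mM} => [|[|m]] //=; rewrite subn2.
Qed.

(** For D = (1-X)(1-2X), the derivative of 1/D is -D'/D^2 with -D' = 3-4X; differentiating the
    truncation error costs one power of ['X]. *)
Lemma phi_deriv : (0 < M)%N ->
  exists T, phi^`() = (3 - 4 *: 'X) * phi ^+ 2 + 'X^(M.-1) * T.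
Proof.
move=> M0; have [R phiR] := phiE.
(* The first term comes from differentiating ['X^M * R], the second from replacing [phi] times D by
   1. *)
exists ((R *+ M + 'X * R^`()) * phi - 'X * R * phi^`()).
have eX : 'X^M = 'X * 'X^(M.-1) :> {poly rat} by rewrite -exprS prednK.
move: phiR; move: phi => p pR; set q := p^`().
have e : ((4 *: 'X - 3) * p + (1 - 'X) * (1 - 2 *: 'X) * q) * p =
    ('X^(M.-1) *+ M * R + 'X^M * R^`()) * p.
  have := congr1 (fun p => p^`()) pR; rewrite /= !derivE -/q !add0r => <-.
  by rewrite -!mul_polyC; ring.
apply: (addIr ('X^M * R * q)).
have -> : q + 'X^M * R * q = (1 - 'X) * (1 - 2 *: 'X) * p * q.
  by rewrite pR mulrDl mul1r.
rewrite [LHS](_ : _ = ((4 *: 'X - 3) * p + (1 - 'X) * (1 - 2 *: 'X) * q) * p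
    - (4 *: 'X - 3) * p ^+ 2); last by ring.
rewrite e eX -(mulr_natl R) -(mulr_natl 'X^(M.-1)); ring.
Qed.

(** Compare coefficients of X^m in the derivative of [phi ^+ N], which is N(3-4X) [phi ^+ N.+1] up
    to an error of degree at least [M.-1]. *)
Lemma coef_phiX_deriv N m : (m.+1 < M)%N ->
  m.+1%:R * (phi ^+ N)`_m.+1 = N%:R *
    (3 * (phi ^+ N.+1)`_m - 4 * (if m is m1.+1 then (phi ^+ N.+1)`_m1 else 0)).
Proof.
move=> mM; have [|T phiT] := phi_deriv; first exact: leq_ltn_trans mM.
rewrite [LHS]mulr_natl [RHS]mulr_natl -coef_deriv deriv_exp coefMn; case: N => [|N].
  by rewrite !mulr0n.
congr (_ *+ _).
have -> : phi^`() * phi ^+ N = 3 *: phi ^+ N.+2 - 4 *: (phi ^+ N.+2 * 'X)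
    + 'X^(M.-1) * (T * phi ^+ N).
  by rewrite phiT !exprS -!mul_polyC; ring.
by rewrite coefD coefB !coefZ coefMX coefXnM [(m < _)%N](_ : _ = true) ?addr0; [case: m {mM}|lia].
Qed.

(* The coefficient of X^N in A^j, where A (1-A) (1-2A) = X; Lagrange inversion
   does not apply at N = 0. *)
Definition lagrange_coef N j : rat :=
  if (j <= N)%N then
    if N is 0 then 1 else j%:R / N%:R * (phi ^+ N)`_(N - j)
  else 0.

(** This is A^(j+1) (1-A)(1-2A) = X A^j read at X^(N+1). It is proved directly from the two
    relations on coefficients of powers of [phi], which bypasses Lagrange inversion. *)
Lemma lagrange_coef_rec N j : (N.+2 < M)%N -> (j <= N)%N ->
  lagrange_coef N.+1 j.+1 - 3 * lagrange_coef N.+1 j.+2 + 2 * lagrange_coef N.+1 j.+3 =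
  lagrange_coef N j.
Proof.
move=> NM /subnK; move: (N - j)%N => m defN.
have c0 : lagrange_coef N.+1 j.+1 = j.+1%:R / N.+1%:R * (phi ^+ N.+1)`_m.
  by rewrite /lagrange_coef ltnS subSS -defN leq_addl addnK.
have c1 : lagrange_coef N.+1 j.+2 = j.+2%:R / N.+1%:R *
    (if m is m1.+1 then (phi ^+ N.+1)`_m1 else 0).
  rewrite /lagrange_coef ltnS subSS -{1 4}defN.
  case: (m) => [|k]; first by rewrite ltnn mulr0.
  by rewrite addSn ltnS leq_addl subSS addnK.
have c2 : lagrange_coef N.+1 j.+3 = j.+3%:R / N.+1%:R *
    (if m is m2.+2 then (phi ^+ N.+1)`_m2 else 0).
  rewrite /lagrange_coef ltnS subSS -{1 4}defN; case: (m) => [|[|k]].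
  - by rewrite ltnNge leqnSn mulr0.
  - by rewrite ltnn mulr0.
  by rewrite !addSn !ltnS leq_addl !subSS addnK.
rewrite c0 c1 c2 {c0 c1 c2}.
(* At [N = 0] the right-hand side is the special value 1. *)
case: N => [|N] in NM defN *.
  have [-> ->] : j = 0%N /\ m = 0%N by lia.
  by rewrite /lagrange_coef /= coef_phiX0 ?(ltn_trans _ NM) // !mulr0 subr0 addr0 mulr1 divr1.
have jN : (j <= N.+1)%N by rewrite -defN leq_addl.
have mE : (N.+1 - j)%N = m by rewrite -defN addnK.
rewrite /lagrange_coef jN mE.
have mM : (m < M)%N by lia.
have r1 := coef_phiX_rec N.+1 mM.
(* This is [coef_phiX_deriv] reindexed from [m.+1] to [m]; at [m = 0] both sides vanish. *)
have r2 : m%:R * (phi ^+ N.+1)`_m = N.+1%:R *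
   (3 * (if m is m1.+1 then (phi ^+ N.+2)`_m1 else 0) -
    4 * (if m is m2.+2 then (phi ^+ N.+2)`_m2 else 0)).
  case: (m) mM => [|k] kM; first by ring.
  by rewrite coef_phiX_deriv.
move: r1 r2.
set y0 := (phi ^+ N.+2)`_m; set y1 := (if m is _.+1 then _ else _).
set y2 := (if m is _.+2 then _ else _); set z := (phi ^+ N.+1)`_m.
have -> : m%:R = N.+1%:R - j%:R :> rat by rewrite -defN natrD addrK.
rewrite -[j.+3]addn3 -[j.+2]addn2 -[j.+1]addn1 -[N.+2]addn1 !natrD.
have: N.+1%:R + 1 != 0 :> rat by rewrite natr1 pnatr_eq0.
have: N.+1%:R != 0 :> rat by rewrite pnatr_eq0.
move: N.+1%:R j%:R y0 y1 y2 z => a b y0 y1 y2 z a0 a1 e0 e.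
(* The two relations eliminate [y0] and [y1], leaving a rational identity in [y2] and [z]. *)
have -> : y0 = z + 3 * y1 - 2 * y2 by rewrite e0; ring.
have -> : y1 = (4 * y2 + (a - b) * z / a) / 3 by rewrite e; field.
by field; apply/andP.
Qed.

Lemma lagrange_coef_formula N j : (N.+1 < M)%N -> (0 < j <= N.+1)%N ->
  lagrange_coef N.+1 j = j%:R / N.+1%:R * 2 ^+ N.+1 *
  \sum_(0 <= k < N.+2)
    gbinom N.+1%:Z k * (- (1 / 2)) ^+ k *
    \sum_(0 <= l < N.+2 - j)
      gbinom (N%:Z - k%:Z + l%:Z) l *
      gbinom (k%:Z + N%:Z - l%:Z - j%:Z) (N.+1 - l - j) * 2 ^+ l.
Proof.
move=> NM /andP[j0 jN]; rewrite /lagrange_coef jN coef_phiX; last by lia.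
rewrite -[RHS]mulrA (subSn jN); congr (_ * (_ * _)); apply: eq_bigr => k _; congr (_ * _).
apply: eq_big_nat => l /andP[_ lm]; congr (_ * _ * _).
  by congr gbinom; lia.
by congr gbinom; lia.
Qed.

End TruncatedSeries.

(** * Solving the recurrence *)

Section Count.
Local Open Scope nat_scope.
Variable n' : nat.
Notation n := n'.+1.
Implicit Types (E : {set {set 'I_n}}) (x : 'I_n).

Lemma ncc_ge_split a k : #|ncc_ge n' a k| = #|ncc n' a k| + #|ncc_ge n' a k.+1|.
Proof.
rewrite -(cardsID [set E | #|uncovered a E| == k]); congr (_ + _); apply: eq_card => E.
  rewrite !(in_setI, in_set) -andbA; congr (_ && _).
  by rewrite andb_idl // => /eqP->.
by rewrite in_setD !in_set andbCA eq_sym -ltn_neqAle.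
Qed.

(** Subtracting [ncc_rec] at [k + 1] from [ncc_rec] at [k] reduces the tail sums to one term; the
    result is arranged to avoid subtraction in [nat]. *)
Lemma ncc_linear x k : x < n' -> 0 < k ->
  #|ncc n' x k.+1| + 2 * #|ncc n' x k.+3| = 3 * #|ncc n' x k.+2| + #|ncc n' x.+1 k|.
Proof.
move=> xn k0; have := ncc_rec xn k0; have := ncc_rec xn (ltn0Sn k).
by rewrite (ncc_ge_split _ k); lia.
Qed.

Lemma uncovered_card a E : #|uncovered a E| <= n - a.
Proof.
rewrite cardE -(size_map val) -(size_iota a (n - a)); apply: uniq_leq_size.
  by rewrite map_inj_uniq ?enum_uniq //; apply: val_inj.
move=> _ /mapP[y + ->]; rewrite mem_enum inE mem_iota => /andP[ay _].
by have := ltn_ord y; rewrite /=; lia.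
Qed.

Lemma ncc_large a k : n - a < k -> #|ncc n' a k| = 0.
Proof.
move=> ak; apply/eqP; rewrite cards_eq0; apply/eqP/setP => E; rewrite in_set0.
by apply/nccP => -[_ Ek]; have := uncovered_card a E; rewrite Ek leqNgt ak.
Qed.

(** The first vertex [x] and the last vertex are distinct and always uncovered. *)
Lemma ncc_small x k : x < n' -> k < 2 -> #|ncc n' x k| = 0.
Proof.
move=> xn k2; apply/eqP; rewrite cards_eq0; apply/eqP/setP => E; rewrite in_set0.
apply/nccP => -[[Ee _ _] Ek]; suff: 1 < #|uncovered x E| by rewrite Ek ltnNge -ltnS k2.
have xN : x != ord_max by rewrite -val_eqE /= ltn_eqF.
rewrite (cardsD1 x) (cardsD1 ord_max) !inE leqnn (uncovered_first Ee) //=.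
by rewrite uncovered_last andbT (ltnW xn) eq_sym xN.
Qed.

Lemma ncc_last k : #|ncc n' n' k| = (k == 1).
Proof.
have uncov E : edges_from n' E -> #|uncovered n' E| = 1.
  move=> Ee; rewrite (_ : uncovered n' E = [set ord_max]) ?cards1 //.
  apply/setP=> y; rewrite !inE -val_eqE /= eqn_leq.
  have := ltn_ord y; rewrite ltnS => -> /=.
  by case: leqP => //= ny; rewrite (uncovered_first Ee) // -ltnS.
have ncc0 : ncc_from n' (set0 : {set {set 'I_n}}).
  split=> [e|x y z u _ _ _|x y xn yn]; rewrite ?inE //.
    by rewrite /adjacent inE.
  rewrite (_ : x = y) ?connect0 //; apply/val_inj/eqP.
  by rewrite /=; have := ltn_ord x; have := ltn_ord y; lia.
have [->|k1] := eqVneq k 1; last first.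
  apply/eqP; rewrite cards_eq0; apply/eqP/setP => E; rewrite in_set0.
  by apply/nccP => -[[Ee _ _]]; rewrite uncov // => /esym/eqP; rewrite (negPf k1).
rewrite -[RHS](cards1 (set0 : {set {set 'I_n}})); apply: eq_card => E; rewrite [RHS]in_set1.
apply/nccP/eqP => [[[Ee _ _] _]|->]; last first.
  by split; [exact: ncc0 | apply: uncov; case: ncc0].
apply/setP=> e; rewrite in_set0; apply/negP => /Ee[u [v [uv nu _]]].
by have := ltn_ord v; lia.
Qed.

(** Both sides satisfy the same linear recurrence and agree on a single vertex, for large [k] and at
    [k = 0]. *)
Lemma card_ncc M a k : n' < M.-1 -> a <= n' ->
  #|ncc n' a k.+1|%:R = lagrange_coef M (n' - a) k.
Proof.
move=> nM an; move defN : (n' - a) => N.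
have {an} -> : a = n' - N by lia.
have {defN} : N <= n' by rewrite -defN leq_subr.
elim: N k => [|N IH] k Nn.
  by rewrite subn0 ncc_last /lagrange_coef leqn0; case: k.
pose x : 'I_n := inord (n' - N.+1).
have xE : x = n' - N.+1 :> nat by rewrite inordK // ltnS leq_subr.
have xn : x < n' by rewrite xE; lia.
have xS : x.+1 = n' - N by rewrite xE; lia.
rewrite -xE.
have large j : N.+1 < j -> #|ncc n' x j.+1|%:R = lagrange_coef M N.+1 j.
  by move=> Nj; rewrite ncc_large ?/lagrange_coef 1?leqNgt ?Nj // xE; lia.
have [Nk|kN] := ltnP N.+1 k; first exact: large.
(* Descending induction on [k], run on [d]: both sides vanish once [N.+1 < k], and a smaller index
   needs the next two. *)
have {kN} [d] : exists d, N.+1 < k + d by exists N.+2; rewrite addnS ltnS leq_addl.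
elim: d k => [|d IHd] k; first by rewrite addn0; apply: large.
case: k => [_|k kd]; first by rewrite ncc_small // /lagrange_coef /= !mul0r.
have [/large//|kN] := ltnP N.+1 k.+1.
have := ncc_linear xn (ltn0Sn k) => /(congr1 (fun i => i%:R : rat)).
rewrite /= natrD natrM [RHS]natrD natrM xS IH ?(ltnW Nn) // (IHd k.+2) ?(IHd k.+3); try lia.
have NM : N.+2 < M by lia.
have {kN} kN : k <= N by [].
rewrite -(lagrange_coef_rec NM kN) => e.
by apply: (addIr (2 * lagrange_coef M N.+1 k.+3)%R); rewrite e; ring.
Qed.

End Count.

(** * Points in convex position *)

Section Geometry.
Variable R : realType.
Implicit Types a b c d z : 'rV[R]_2.

Lemma orient_line a b c d t :
  orient a b ((1 - t) *: c + t *: d) = (1 - t) * orient a b c + t * orient a b d.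
Proof. by rewrite /orient !mxE; ring. Qed.

Lemma orient_cycle a b c : orient a b c = orient b c a.
Proof. by rewrite /orient; ring. Qed.

Lemma orient_swap a b c : orient a c b = - orient a b c.
Proof. by rewrite /orient; ring. Qed.

Lemma orient_left a b : orient a b a = 0. Proof. by rewrite /orient; ring. Qed.

Lemma orient_right a b : orient a b b = 0. Proof. by rewrite /orient; ring. Qed.

Lemma segment_orient a b z : segment a b z -> orient a b z = 0.
Proof. by move=> [t _ <-]; rewrite orient_line orient_left orient_right !mulr0 addr0. Qed.

Lemma segmentC a b z : segment a b z -> segment b a z.
Proof.
move=> [t]; rewrite set_interval.set_itvE /= => t01 <-; exists (1 - t).
  by rewrite set_interval.set_itvE /=; lra.
by rewrite subKr addrC.
Qed.

Lemma open_segment_sub a b z : open_segment a b z -> segment a b z.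
Proof.
move=> [t]; rewrite set_interval.set_itvE /= => t01 <-; exists t => //.
by rewrite set_interval.set_itvE /=; lra.
Qed.

(** The diagonal [bd] divides [ac] in the ratio of the areas of [abd] and [bcd], and similarly for
    [ac] on [bd]; [sum_eq] computes twice the area of the quadrilateral in two ways. *)
Lemma diagonals_cross a b c d :
  0 < orient a b c -> 0 < orient a b d -> 0 < orient a c d -> 0 < orient b c d ->
  exists z, open_segment a c z /\ open_segment b d z.
Proof.
move=> abc abd acd bcd.
have sum_eq : orient a b d + orient b c d = orient a b c + orient a c d.
  by rewrite /orient; ring.
set S := orient a b d + orient b c d in sum_eq.
have S0 : 0 < S by rewrite addr_gt0.
have S0' : S != 0 by rewrite gt_eqF.
exists ((1 - orient a b d / S) *: a + (orient a b d / S) *: c); split.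
  exists (orient a b d / S) => //; rewrite set_interval.set_itvE /=.
  by rewrite divr_gt0 //= ltr_pdivrMr // mul1r ltrDl.
exists (orient a b c / S).
  rewrite set_interval.set_itvE /=.
  by rewrite divr_gt0 //= ltr_pdivrMr // mul1r sum_eq ltrDl.
move: S0'; rewrite /S /orient => S0'.
apply/rowP => i; rewrite !mxE.
have [->|->] : i = 0 \/ i = 1.
  by case: i => -[|[|//]] ?; [left|right]; apply: val_inj.
- by field.
- by field.
Qed.

(** * Sides of a chord in a counter-clockwise family *)

Section Points.
Variables (m : nat) (P : 'I_m -> 'rV[R]_2).
Hypothesis ccwP : ccw_labelled P.
Implicit Types i j k l : 'I_m.

Lemma orient_in i j k : (i < k < j)%N -> orient (P i) (P j) (P k) < 0.
Proof. by move=> /andP[ik kj]; rewrite orient_swap oppr_lt0 ccwP. Qed.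

Lemma orient_out i j k : (i < j)%N -> (k < i)%N || (j < k)%N ->
  0 < orient (P i) (P j) (P k).
Proof.
by move=> ij /orP[ki|jk]; [rewrite -orient_cycle ccwP | rewrite ccwP].
Qed.

Lemma orient_eq0 i j k : (i < j)%N -> orient (P i) (P j) (P k) = 0 ->
  k = i \/ k = j.
Proof.
move=> ij o0; have [ki|ik|/val_inj] := ltngtP k i; last by left.
  by have := @orient_out i j k ij; rewrite ki o0 ltxx => /(_ isT).
have [kj|jk|/val_inj] := ltngtP k j; last by right.
  by have := @orient_in i j k; rewrite ik kj o0 ltxx => /(_ isT).
by have := @orient_out i j k ij; rewrite jk orbT o0 ltxx => /(_ isT).
Qed.

Lemma orient_in_le i j k : (i <= k <= j)%N -> orient (P i) (P j) (P k) <= 0.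
Proof.
move=> /andP[]; rewrite leq_eqVlt => /orP[/eqP/val_inj-> _|ik].
  by rewrite orient_left.
rewrite leq_eqVlt => /orP[/eqP/val_inj->|kj]; first by rewrite orient_right.
by apply/ltW/orient_in; rewrite ik.
Qed.

Lemma orient_out_ge i j k : (i < j)%N -> (k <= i)%N || (j <= k)%N ->
  0 <= orient (P i) (P j) (P k).
Proof.
move=> ij; rewrite leq_eqVlt => /orP[/orP[/eqP/val_inj->|ki]|].
- by rewrite orient_left.
- by apply/ltW/orient_out; rewrite ?ki.
rewrite leq_eqVlt => /orP[/eqP/val_inj->|jk]; first by rewrite orient_right.
by apply/ltW/orient_out; rewrite ?jk ?orbT.
Qed.

(** For [i < j], the chord [ij] splits the indices into two arcs. They are closed, so chords that
    share an endpoint are allowed. *)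
Definition same_side i j k l :=
  (i <= k <= j)%N && (i <= l <= j)%N ||
  ((k <= i)%N || (j <= k)%N) && ((l <= i)%N || (j <= l)%N).

(** Along [kl] the orientation relative to [ij] is affine, and it vanishes at [z]. Its two weighted
    end values have equal sign, so both are 0. *)
Lemma same_side_meet i j k l z : (i < j)%N -> same_side i j k l ->
  segment (P i) (P j) z -> segment (P k) (P l) z ->
  [\/ z = P k /\ (k = i \/ k = j), z = P l /\ (l = i \/ l = j) |
      (k = i \/ k = j) /\ (l = i \/ l = j)].
Proof.
move=> ij side /segment_orient zij [t].
rewrite set_interval.set_itvE /= => /andP[t0 t1] def_z.
move: zij; rewrite -def_z orient_line.
set ok := orient _ _ (P k); set ol := orient _ _ (P l) => sum0.
have prods0 : (1 - t) * ok = 0 /\ t * ol = 0.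
  case/orP: side => /andP[sk sl].
    have ok0 : ok <= 0 by exact: orient_in_le.
    have ol0 : ol <= 0 by exact: orient_in_le.
    by nra.
  have ok0 : 0 <= ok by exact: orient_out_ge.
  have ol0 : 0 <= ol by exact: orient_out_ge.
  by nra.
case: prods0 => /eqP; rewrite mulf_eq0 => /orP[t1'|/eqP ok0] /eqP.
  have -> : t = 1 by apply/eqP; rewrite eq_sym -subr_eq0.
  rewrite mul1r => /eqP ol0; apply: Or32; rewrite subrr scale0r scale1r add0r.
  by split=> //; apply: orient_eq0 ol0.
rewrite mulf_eq0 => /orP[/eqP->|/eqP ol0].
  apply: Or31; rewrite subr0 scale0r scale1r addr0.
  by split=> //; apply: orient_eq0 ok0.
by apply: Or33; split; [apply: orient_eq0 ok0 | apply: orient_eq0 ol0].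
Qed.

Lemma ccw_cross i j k l : (i < k)%N -> (k < j)%N -> (j < l)%N ->
  exists z, open_segment (P i) (P j) z /\ open_segment (P k) (P l) z.
Proof.
move=> ik kj jl; apply: diagonals_cross; apply: ccwP => //.
  exact: ltn_trans jl.
exact: ltn_trans kj.
Qed.

End Points.

(** * From geometric graphs to noncrossing graphs *)

Section Graphs.
Variables (n' : nat) (p : 'I_n'.+1 -> 'rV[R]_2) (q : 'rV[R]_2).
Hypotheses (ccwp : ccw_labelled p) (ccwq : ccw_labelled (add_point p q)).
Implicit Types (E : {set {set 'I_n'.+1}}).

Lemma plane_graphP E : edges_from 0 E -> plane_graph p E <-> noncrossing E.
Proof.
move=> Ee; split=> [plane x y z u xy yz zu xz yu|nc].
  have [w [wxz wyu]] := ccw_cross ccwp xy yz zu.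
  have neq : [set x; z]%SET != [set y; u]%SET.
    by rewrite set2_eq -!val_eqE /=; lia.
  have yu_lt := ltn_trans yz zu.
  have [+ _] := plane x z y u xz yu neq w (open_segment_sub wxz) (open_segment_sub wyu).
  have o0 := segment_orient (open_segment_sub wyu).
  (* The crossing point would be an endpoint of [xz] lying on the line through [p y] and [p u],
     against strict convexity. *)
  by case=> ew; move: o0; rewrite ew => /(orient_eq0 ccwp yu_lt)[] /(congr1 val) /=; lia.
have wlog_plane (i j k l : 'I_n'.+1) z : (i < j)%N -> adjacent E i j -> adjacent E k l ->
    ([set i; j] != [set k; l])%SET ->
    segment (p i) (p j) z -> segment (p k) (p l) z ->
    ([set p i; p j] z /\ [set p k; p l] z)%classic.
  move=> ij Eij Ekl neq zij zkl.
  have side : same_side i j k l.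
    have Elk : adjacent E l k by rewrite adjC.
    (* These are the four ways in which [k] and [l] can lie strictly on opposite sides of [ij]. *)
    have n1 : ~~ [&& i < k, k < j & j < l]%N.
      by apply/negP => /and3P[ik kj jl]; apply: nc ik kj jl Eij Ekl.
    have n2 : ~~ [&& l < i, i < k & k < j]%N.
      by apply/negP => /and3P[li ik kj]; apply: nc li ik kj Elk Eij.
    have n3 : ~~ [&& i < l, l < j & j < k]%N.
      by apply/negP => /and3P[il lj jk]; apply: nc il lj jk Eij Elk.
    have n4 : ~~ [&& k < i, i < l & l < j]%N.
      by apply/negP => /and3P[ki il lj]; apply: nc ki il lj Ekl Eij.
    by rewrite /same_side; lia.
  have [_ _ kl] := adj_from Ee Ekl.
  case: (same_side_meet ccwp ij side zij zkl) => [[-> ki]|[-> li]|[ki lj]].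
  - by split; [case: ki => ->; [left|right] | left].
  - by split; [case: li => ->; [left|right] | right].
  move: kl neq; rewrite set2_eq.
  by case: ki => ->; case: lj => ->; rewrite !eqxx ?orbT.
move=> i j k l Eij Ekl neq z zij zkl.
have [_ _] := adj_from Ee Eij; rewrite -val_eqE neq_ltn => /orP[ij|ji].
  exact: wlog_plane.
have [||] := wlog_plane j i k l z ji _ Ekl _ (segmentC zij) zkl.
- by rewrite adjC.
- by rewrite finset.setUC.
by rewrite classical_sets.setUC.
Qed.

(** With [q] as last point of the extended family, the line of sight is a chord from [i] to
    [ord_max], which an edge crosses exactly when it covers [i]. *)
Lemma visibleP E (i : 'I_n'.+1) : edges_from 0 E ->
  visible p E q (p i) <-> ~~ covered E i.
Proof.
move=> Ee; have pE k : p k = add_point p q (lift ord_max k).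
  by rewrite /add_point liftK.
have qE : q = add_point p q ord_max by rewrite /add_point unlift_none.
split=> [vis|/coveredP ucov k l Ekl].
  apply/coveredP => -[k [l [ki il Ekl]]].
  have [|||z [zkl ziq]] := @ccw_cross _ _ ccwq (lift ord_max k) (lift ord_max l)
    (lift ord_max i) ord_max; rewrite ?lift_max ?ltn_ord //.
  suff : classical_sets.set0 z by [].
  rewrite -(vis k l Ekl); split; last by rewrite !pE.
  by rewrite qE pE; apply/segmentC/open_segment_sub.
apply/seteqP; split=> // z [/segmentC ziq zkl].
have [_ _ kl] := adj_from Ee Ekl.
have iN : (lift ord_max i < @ord_max n'.+1)%N by rewrite lift_max ltn_ord.
have notmax (h : 'I_n'.+1) : lift ord_max h = lift ord_max i \/
    lift ord_max h = ord_max -> h = i.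
  by case=> [/lift_inj//|/eqP]; rewrite eq_sym (negPf (neq_lift _ _)).
have side : same_side (lift ord_max i) (@ord_max n'.+1) (lift ord_max k) (lift ord_max l).
  have n1 : ~~ [&& k < i & i < l]%N.
    by apply/negP => /andP[ki il]; apply: ucov; exists k, l.
  have n2 : ~~ [&& l < i & i < k]%N.
    by apply/negP => /andP[li ik]; apply: ucov; exists l, k; rewrite adjC.
  have := ltn_ord k; have := ltn_ord l.
  by rewrite /same_side !lift_max /=; lia.
have [t + def_z] := zkl; rewrite set_interval.set_itvE /= => /andP[t0 t1].
move: ziq zkl; rewrite qE !pE => ziq /open_segment_sub zkl.
have := segment_orient ziq; rewrite -def_z orient_line !pE => o0.
have [[_ /notmax ki]|[_ /notmax li]|[/notmax ki /notmax li]] :=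
  same_side_meet ccwq iN side ziq zkl.
(* As [t] is strictly inside the unit interval, the other endpoint is also on the line through [p i]
   and [q], so it is [i] too and the edge would be a loop. *)
- move: o0; rewrite ki orient_left mulr0 add0r => /eqP.
  rewrite mulf_eq0 gt_eqF //= => /eqP/(orient_eq0 ccwq iN)/notmax li.
  by rewrite ki li eqxx in kl.
- move: o0; rewrite li orient_left mulr0 addr0 => /eqP.
  rewrite mulf_eq0 gt_eqF ?subr_gt0 //= => /eqP/(orient_eq0 ccwq iN)/notmax ki.
  by rewrite ki li eqxx in kl.
by rewrite ki li eqxx in kl.
Qed.

(** Degree [k - 1] means [k + 1] visible vertices, because the degree subtracts 2. *)
Lemma connected_plane_graphsE k :
  connected_plane_graphs p q (k%:Z - 1) = ncc n' 0 k.+1.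
Proof.
apply/setP=> E; rewrite finset.in_set; apply/and4P/nccP.
  case=> [/forallP E2 /asboolP plane conn /eqP vis].
  have Ee : edges_from 0 E.
    by apply/edges_fromP; split=> // e eE; apply/eqP; have := E2 e; rewrite eE.
  split.
    split=> //; first exact/plane_graphP.
    by move=> x y _ _; have /forallP/(_ x)/forallP := conn.
  move: vis; rewrite /visibility_degree (eq_card (B := uncovered 0 E)); first by lia.
  move=> x; rewrite unfold_in /= finset.in_set leq0n /=.
  by apply/asboolP/idP; apply visibleP.
case=> -[Ee nc conn] Ek; split.
- by apply/forallP => e; apply/implyP => eE; have [-> //] := (edges_fromP 0 E).1 Ee.
- exact/asboolP/plane_graphP.
- by apply/forallP => x; apply/forallP => y; apply: conn.
rewrite /visibility_degree (eq_card (B := uncovered 0 E)); first by rewrite Ek; lia.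
move=> x; rewrite unfold_in /= finset.in_set leq0n /=.
by apply/asboolP/idP; apply visibleP.
Qed.

End Graphs.
End Geometry.

Theorem theorem12 (R : realType) (n : nat) (hn : (2 <= n)%N)
    (p : 'I_n -> 'rV[R]_2) (hp : ccw_convex p)
    (q : 'rV[R]_2) (hq : ccw_convex (add_point p q))
    (j : nat) (hj : (1 <= j <= n - 1)%N) :
  (#|connected_plane_graphs p q (j%:Z - 1)|)%:R =
    j%:R / (n%:R - 1) * 2 ^+ (n - 1) *
    \sum_(0 <= k < n)
      gbinom (n%:Z - 1) k * (- (1 / 2)) ^+ k *
      \sum_(0 <= l < n - j)
        gbinom (n%:Z - 2 - k%:Z + l%:Z) l *
        gbinom (k%:Z + n%:Z - l%:Z - j%:Z - 2) (n - l - j - 1) * 2 ^+ l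
  :> rat.
Proof.
have [_ ccwp] := hp; have [_ ccwq] := hq.
case: n hn p {hp} q {hq} hj ccwp ccwq => [|[|N]] // _ p q hj ccwp ccwq.
(* The truncation order [N.+4] is large enough for [card_ncc] with [n' = N.+1]. *)
rewrite (connected_plane_graphsE ccwp ccwq) (@card_ncc _ N.+4) // subn0.
have jN : (0 < j <= N.+1)%N by move: hj; rewrite subn1.
have NM : (N.+1 < N.+4)%N by rewrite !ltnS ltnW.
rewrite lagrange_coef_formula // subn1 -[N.+2]addn1 natrD addrK addn1.
congr (_ * _); apply: eq_bigr => k _; congr (_ * _).
apply: eq_big_nat => l /andP[_ lm]; congr (_ * _ * _).
  by congr gbinom; lia.
by congr gbinom; lia.
Qed.
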